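(* Let $\bar C^{-1}_0$, $\bar D^{-1}_0$ and $\bar D^j_k$ ($j=0,\dots,n$, $k\in\mathcal{K}(j)$) be the collections of vectors produced by the adapted discrete hierarchical basis construction of degree $p$ (with coarse degree $m\le p$) for the node set $X$ of cardinality $N$. Then the basis of $\mathbb{R}^N$ consisting of all the vectors in $\bar C^{-1}_0$, $\bar D^{-1}_0$ and $\bar D^j_k$, $j=0,\dots,n$, $k\in\mathcal{K}(j)$, forms an orthonormal set.
   Context: Let $X=\{\vec x_1,\dots,\vec x_N\}\subset[0,1]^3$ be distinct nodes, and let $0\le m\le p$ be integers with $X$ unisolvent for polynomials of degree at most $m$ (only the zero polynomial of degree at most $m$ vanishes on $X$). For $d\ge 0$, $\mathcal{P}^d(X)\subset\mathbb{R}^N$ is the space of vectors $(q(\vec x_1),\dots,q(\vec x_N))$ with $q$ a polynomial in three variables of total degree at most $d$; $M(d)=\binom{d+3}{3}$; $Q_d$ is a matrix whose columns form a basis of $\mathcal{P}^d(X)$; $e_i$ is the $i$-th standard unit vector of $\mathbb{R}^N$, associated with node $\vec x_i$. Tree of cubes: start with $B^0_0=[0,1]^3$ at level $0$; a cube at level $j$ containing more than $M(p)$ nodes is partitioned into eight congruent subcubes at level $j+1$ (each node is assigned to exactly one of them), the nonempty ones being its children. The procedure stops when every cube that has not been subdivided contains at most $M(p)$ nodes; $n$ is the largest level reached and $\mathcal{K}(j)$ indexes the nonempty cubes $B^j_k$ of level $j$. Decomposition of degree $d$: given orthonormal vectors $v_1,\dots,v_s\in\mathbb{R}^N$, put $V=[v_1,\dots,v_s]$,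 $M_{s,d}=Q_d^{T}V$, $a=\mathrm{rank}\,M_{s,d}$, and take a full set of right singular vectors of $M_{s,d}$, i.e. an orthonormal basis $g_1,\dots,g_s$ of $\mathbb{R}^s$ in which $g_{a+1},\dots,g_s$ is an orthonormal basis of the null space of $M_{s,d}$. Set $\phi_l=Vg_l$ for $1\le l\le a$ (average vectors) and $\psi_l=Vg_l$ for $a+1\le l\le s$ (detail vectors). Hierarchical basis: proceed from level $n$ down to level $0$. For each nonempty cube $B^j_k$, let $\mathbf{B}^j_k=\{e_i:\vec x_i\in B^j_k\}$ if $B^j_k$ has no children, and let $\mathbf{B}^j_k$ be the union of the sets $\bar C^{j+1}_l$ over the children $B^{j+1}_l$ of $B^j_k$ otherwise. Apply the decomposition of degree $p$ to $\mathbf{B}^j_k$; $\bar C^j_k$ is the resulting set of average vectors and $\bar D^j_k$ the resulting set of detail vectors. Finally apply the decomposition of degree $m$ to $\bar C^0_0$; $\bar C^{-1}_0$ and $\bar D^{-1}_0$ are the resulting sets of average and detail vectors respectively. *)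

(* Defs.v *)
From HB Require Import structures.
From mathcomp Require Import all_boot all_order all_algebra.
From mathcomp Require Import reals mpoly.

Set Implicit Arguments.
Unset Strict Implicit.
Unset Printing Implicit Defensive.

Import Order.TTheory GRing.Theory Num.Theory.
Local Open Scope ring_scope.

Section LinearAlgebra.
Variable R : realType.

Definition dot_prod n (u v : 'cV[R]_n) : R := \sum_(i < n) u i 0 * v i 0.

(* As a condition on the family indexed by positions, this also rules out
   repeated vectors. *)
Definition orthonormal_seq n (s : seq 'cV[R]_n) : Prop :=
  forall i j, (i < size s)%N -> (j < size s)%N ->
    dot_prod s`_i s`_j = (i == j)%:R.

Definition is_basis n (s : seq 'cV[R]_n) (P : 'cV[R]_n -> Prop) : Prop :=
  free s /\ forall v, v \in <<s>>%VS <-> P v.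

Definition cols_of n (vs : seq 'cV[R]_n) : 'M[R]_(n, size vs) :=
  \matrix_(i, l) vs`_l i 0.

Definition unit_vec n (i : 'I_n) : 'cV[R]_n := delta_mx i 0.

(* Finite sets of vectors are given by lists; [vs] is any duplicate-free
   enumeration of the set [S].  With [Q] the matrix of a basis of P^d(X), the
   list [gs] is a full set of right singular vectors of [Q^T *m V], and
   [C], [D] are the average and detail vectors.  Orthonormality of [S] is not
   part of the relation. *)
Definition decomposition n r (Q : 'M[R]_(n, r)) (S C D : seq 'cV[R]_n) : Prop :=
  exists (vs : seq 'cV[R]_n) (gs : seq 'cV[R]_(size vs)),
    let V := cols_of vs in
    let M := Q^T *m V in
    let a := \rank M in
    [/\ uniq vs /\ vs =i S,
        orthonormal_seq gs /\ basis_of fullv gs,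
        orthonormal_seq (drop a gs) /\ is_basis (drop a gs) (fun g => M *m g = 0),
        C = [seq V *m g | g <- take a gs]
      & D = [seq V *m g | g <- drop a gs]].

End LinearAlgebra.

Section Nodes.
Variables (R : realType) (N : nat) (x : 'I_N -> 'rV[R]_3).

Definition poly_deg_le d (q : {mpoly R[3]}) : bool := (msize q <= d.+1)%N.

Definition unisolvent d : Prop :=
  forall q : {mpoly R[3]}, poly_deg_le d q ->
    (forall i, q.@[x i 0] = 0) -> q = 0.

Definition poly_space d (v : 'cV[R]_N) : Prop :=
  exists2 q : {mpoly R[3]}, poly_deg_le d q & v = \col_i q.@[x i 0].

Definition poly_basis_mx d r (Q : 'M[R]_(N, r)) : Prop :=
  is_basis [seq col l Q | l <- enum 'I_r] (poly_space d).

End Nodes.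

(* The cube of level j and index k is
   \prod_c [k_c / 2^j, (k_c + 1) / 2^j]. *)
Notation cube_index := {ffun 'I_3 -> nat}.

Definition root_cube : cube_index := [ffun=> 0%N].

Definition parent (k : cube_index) : cube_index := [ffun c => (k c)./2].

Definition in_cube (R : realType) (j : nat) (k : cube_index) (y : 'rV[R]_3) :
    Prop :=
  forall c, (k c)%:R / 2 ^+ j <= y 0 c <= (k c).+1%:R / 2 ^+ j.

(* [cell j i] is the cube of level j to which node i is assigned; a node on a
   common face of several closed cubes may be assigned to any one of them.  Below
   a cube which is not subdivided the values of [cell] play no role. *)
Definition assignment (R : realType) N (x : 'I_N -> 'rV[R]_3)
    (cell : nat -> 'I_N -> cube_index) : Prop :=
  [/\ forall i, cell 0%N i = root_cube,
      forall j i, parent (cell j.+1 i) = cell j i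
    & forall j i, in_cube j (cell j i) (x i)].

Section Tree.
Variables (N p : nat) (cell : nat -> 'I_N -> cube_index).

Definition max_nodes : nat := 'C(p + 3, 3).

Definition nodes j (k : cube_index) : {set 'I_N} := [set i | cell j i == k].

Fixpoint in_tree j (k : cube_index) : bool :=
  if j is j'.+1 then
    [&& in_tree j' (parent k), (max_nodes < #|nodes j' (parent k)|)%N
      & nodes j k != set0]
  else k == root_cube.

(* The index set K(j). *)
Definition cubes j : seq cube_index :=
  [seq k <- undup (codom (cell j)) | in_tree j k].

Definition children j (k : cube_index) : seq cube_index :=
  [seq l <- cubes j.+1 | parent l == k].

Definition largest_level (n : nat) : Prop :=
  (exists k, k \in cubes n) /\ forall j k, k \in cubes j -> (j <= n)%N.

End Tree.

Section Hierarchy.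
Variables (R : realType) (N p m : nat) (cell : nat -> 'I_N -> cube_index).
Variables (r : nat -> nat) (Q : forall d, 'M[R]_(N, r d)).
Variables (C D : nat -> cube_index -> seq 'cV[R]_N).

Definition cube_vectors j (k : cube_index) : seq 'cV[R]_N :=
  if children p cell j k is [::] then
    [seq unit_vec R i | i <- enum (nodes cell j k)]
  else flatten [seq C j.+1 l | l <- children p cell j k].

(* [C j k], [D j k] matter only for j <= n and k in K(j); [C'], [D'] are the
   vectors of level -1. *)
Definition hierarchical_basis (n : nat) (C' D' : seq 'cV[R]_N) : Prop :=
  (forall j k, (j <= n)%N -> k \in cubes p cell j ->
     decomposition (Q p) (cube_vectors j k) (C j k) (D j k)) /\
  decomposition (Q m) (C 0%N root_cube) C' D'.

Definition all_vectors (n : nat) (C' D' : seq 'cV[R]_N) : seq 'cV[R]_N :=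
  C' ++ D' ++ flatten [seq D j k | j <- iota 0 n.+1, k <- cubes p cell j].

End Hierarchy.

(* Main.v *)
Require Import Defs.
From HB Require Import structures.
From mathcomp Require Import all_boot all_order all_algebra.
From mathcomp Require Import reals mpoly.

Set Implicit Arguments.
Unset Strict Implicit.
Unset Printing Implicit Defensive.

Import Order.TTheory GRing.Theory Num.Theory.
Local Open Scope ring_scope.

(** The construction is a chain of replacements that starts from the standard
    basis [e_1, ..., e_N].  If [S ++ T] is an orthonormal list and [C], [D] are
    the average and detail vectors of a decomposition of [S], then
    [C ++ D ++ T] is orthonormal too and has the same length: writing [V] for
    the matrix of the vectors of [S], [V^T V = 1], so [C ++ D] is the image of
    an orthonormal basis under the isometry [V], and it stays in the span of
    [S], hence orthogonal to [T] (lemma [decomposition_replaces]).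

    Going up the tree, the replacements are made one level at a time.  Just
    before level [j] is treated, the list consists of the details of all the
    finer levels and of a frontier: the averages of the cubes of level [j.+1],
    and the unit vectors of the nodes that are not in any cube of the tree of
    level [j.+1], because they lie in a leaf of level at most [j].  Up to order,
    this frontier consists of the inputs of the cubes of level [j] and the unit
    vectors still waiting for a coarser leaf (lemma
    [perm_frontier_inputs]), so decomposing every cube of level [j] yields
    the next frontier and the details of level [j].  At level [0] the frontier
    has shrunk to the averages of the root, which the last decomposition
    replaces by the vectors of level [-1].  The outcome is an orthonormal list
    of [N] vectors, hence a basis of [R^N]. *)

(** * Orthonormal lists *)

Section Orthonormal.
Variable R : realType.

Lemma dot_prodE n (u v : 'cV[R]_n) : dot_prod u v = (u^T *m v) 0 0.
Proof. by rewrite mxE; apply: eq_bigr => i _; rewrite mxE. Qed.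

Lemma dot_prodC n (u v : 'cV[R]_n) : dot_prod u v = dot_prod v u.
Proof. by apply: eq_bigr => i _; rewrite mulrC. Qed.

(** Positions are convenient for matrices of vectors, but this form is the one
    that shows that the order of the list does not matter. *)
Lemma orthonormal_seqP n (s : seq 'cV[R]_n) :
  orthonormal_seq s <->
  uniq s /\ {in s &, forall u v, dot_prod u v = (u == v)%:R}.
Proof.
split=> [os | [us os] i j lti ltj]; last first.
  by rewrite os ?mem_nth // nth_uniq.
have us : uniq s.
  apply/(uniqP 0) => i j lti ltj eqij; have := os i j lti ltj.
  rewrite eqij os // eqxx; case: eqP => // _ /eqP.
  by rewrite oner_eq0.
split=> // _ _ /(nthP 0)[i lti <-] /(nthP 0)[j ltj <-].
by rewrite os // nth_uniq.
Qed.

Lemma orthonormal_perm n (s t : seq 'cV[R]_n) :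
  perm_eq s t -> orthonormal_seq s -> orthonormal_seq t.
Proof.
move=> st /orthonormal_seqP[us os]; apply/orthonormal_seqP.
split; first by rewrite -(perm_uniq st).
by move=> u v; rewrite -!(perm_mem st); apply: os.
Qed.

Lemma orthonormal_cat n (s t : seq 'cV[R]_n) :
  orthonormal_seq (s ++ t) <->
  [/\ orthonormal_seq s, orthonormal_seq t
    & {in s & t, forall u v, dot_prod u v = 0}].
Proof.
split=> [/orthonormal_seqP[]|].
  rewrite cat_uniq => /and3P[us /hasPn st ut] ost; split.
  - apply/orthonormal_seqP; split=> // u v us' vs'.
    by apply: ost; rewrite mem_cat ?us' ?vs'.
  - apply/orthonormal_seqP; split=> // u v us' vs'.
    by apply: ost; rewrite mem_cat ?us' ?vs' orbT.
  - move=> u v us' vt'; rewrite ost ?mem_cat ?us' ?vt' ?orbT //.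
    by case: eqP us' => // ->; rewrite (negPf (st _ vt')).
case=> /orthonormal_seqP[us os] /orthonormal_seqP[ut ot] ost.
(* A common vector would have square norm both 1 and 0. *)
have disj u : u \in s -> u \in t -> False.
  move=> us' ut'; have := os u u us' us'; rewrite ost // eqxx => /esym/eqP.
  by rewrite oner_eq0.
apply/orthonormal_seqP; split.
  rewrite cat_uniq us ut andbT /=; apply/hasPn => u ut'.
  by apply/negP => us'; apply: disj us' ut'.
move=> u v; rewrite !mem_cat => /orP[us'|ut'] /orP[vs'|vt'].
- exact: os.
- by rewrite ost //; case: eqP us' => // -> /disj /(_ vt').
- by rewrite dot_prodC ost //; case: eqP ut' => // -> /(disj _ vs').
- exact: ot.
Qed.

Lemma orthonormal_free n (s : seq 'cV[R]_n) : orthonormal_seq s -> free s.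
Proof.
move=> os; apply/(@freeP _ _ _ (in_tuple s)) => k k0 i.
have : dot_prod s`_i (\sum_(j < size s) k j *: (in_tuple s)`_j) = 0.
  by rewrite k0 dot_prodE mulmx0 mxE.
rewrite dot_prodE mulmx_sumr summxE (bigD1 i) //= big1 ?addr0.
  by rewrite -scalemxAr mxE -dot_prodE os // eqxx mulr1.
move=> j ji; rewrite -scalemxAr mxE -dot_prodE os //.
by rewrite eq_sym (inj_eq val_inj) (negPf ji) mulr0.
Qed.

Lemma orthonormal_basis n (s : seq 'cV[R]_n) :
  orthonormal_seq s -> size s = n -> basis_of fullv s.
Proof.
move=> os ss; rewrite basisEfree orthonormal_free // subvf /=.
by rewrite dimvf dim_matrix mulr1 ss.
Qed.

Lemma orthonormal_unit_vec n :
  orthonormal_seq [seq unit_vec R i | i <- enum 'I_n].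
Proof.
have dotE (i j : 'I_n) : dot_prod (unit_vec R i) (unit_vec R j) = (i == j)%:R.
  rewrite /dot_prod (bigD1 i) //= big1 => [|k ki].
    by rewrite !mxE !eqxx addr0 mul1r andbT.
  by rewrite !mxE (negPf ki) mul0r.
have e_inj : injective (@unit_vec R n).
  move=> i j eij; have := dotE i j; rewrite -eij dotE eqxx.
  by case: eqP => // _ /eqP; rewrite oner_eq0.
apply/orthonormal_seqP; split; first by rewrite map_inj_uniq ?enum_uniq.
by move=> _ _ /mapP[i _ ->] /mapP[j _ ->]; rewrite dotE (inj_eq e_inj).
Qed.

Lemma tr_cols_of_mul n (vs : seq 'cV[R]_n) :
  orthonormal_seq vs -> (cols_of vs)^T *m cols_of vs = 1%:M.
Proof.
move=> ov; apply/matrixP => i j; rewrite !mxE -val_eqE -(ov i j) //.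
by apply: eq_bigr => k _; rewrite !mxE.
Qed.

(** * Replacing part of an orthonormal list *)

(** Quantifying over the rest [r] of the list is what makes replacement
    compatible with concatenation: orthonormality of [s] and [t] alone says
    nothing of the vectors that accompany them.  The sizes are compared under
    the same hypothesis because a decomposition sees [s] as a set: only
    orthonormality excludes repetitions. *)
Definition replaces n (s t : seq 'cV[R]_n) : Prop :=
  forall r, orthonormal_seq (s ++ r) ->
    size t = size s /\ orthonormal_seq (t ++ r).

Lemma replaces_perm n (s t : seq 'cV[R]_n) : perm_eq s t -> replaces s t.
Proof.
move=> st r osr; split; first exact/esym/perm_size.
by apply: orthonormal_perm osr; rewrite perm_cat2r.
Qed.

Lemma replaces_trans n (s t u : seq 'cV[R]_n) :
  replaces s t -> replaces t u -> replaces s u.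
Proof. by move=> st tu r /st[<- /tu]. Qed.

Lemma replaces_cat n (s1 t1 s2 t2 : seq 'cV[R]_n) :
  replaces s1 t1 -> replaces s2 t2 -> replaces (s1 ++ s2) (t1 ++ t2).
Proof.
move=> st1 st2 r; rewrite -catA !size_cat => /st1[-> o1].
have /st2[-> o2] : orthonormal_seq (s2 ++ t1 ++ r).
  by apply: orthonormal_perm o1; rewrite perm_catCA.
by split=> //; rewrite -catA; apply: orthonormal_perm o2; rewrite perm_catCA.
Qed.

Lemma replaces_flatten n (I : eqType) (ks : seq I) (S C D : I -> seq 'cV[R]_n) :
  {in ks, forall k, replaces (S k) (C k ++ D k)} ->
  replaces (flatten [seq S k | k <- ks])
    (flatten [seq C k | k <- ks] ++ flatten [seq D k | k <- ks]).
Proof.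
elim: ks => [_|k ks IH hyp] /=; first exact: replaces_perm.
have rk := hyp k (mem_head k ks).
have rks : replaces (flatten [seq S k | k <- ks])
    (flatten [seq C k | k <- ks] ++ flatten [seq D k | k <- ks]).
  by apply: IH => l lks; apply: hyp; rewrite inE lks orbT.
apply: replaces_trans (replaces_cat rk rks) (replaces_perm _).
by rewrite -!catA perm_cat2l perm_catCA.
Qed.

(** The matrix [V] of an orthonormal list is an isometry, so it carries the
    orthonormal basis of singular vectors to an orthonormal list, inside the
    span of the columns of [V]. *)
Lemma decomposition_replaces n q (Q : 'M[R]_(n, q)) (S C D : seq 'cV[R]_n) :
  decomposition Q S C D -> replaces S (C ++ D).
Proof.
case=> vs [gs [[uvs vsS] [ogs bgs] _ -> ->]] r oSr.
set V := cols_of vs; rewrite -map_cat cat_take_drop.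
have uS : uniq S by case/orthonormal_cat: oSr => /orthonormal_seqP[].
have pS : perm_eq S vs by rewrite perm_sym; apply: uniq_perm.
have /orthonormal_cat[ovs or ovr] : orthonormal_seq (vs ++ r).
  by apply: orthonormal_perm oSr; rewrite perm_cat2r.
split.
  rewrite size_map (perm_size pS).
  rewrite -[LHS](vector.size_basis (X := in_tuple gs) bgs).
  by rewrite dimvf dim_matrix mulr1.
apply/orthonormal_cat; split=> //.
- move=> i j; rewrite size_map => lti ltj.
  rewrite !(nth_map 0) // dot_prodE trmx_mul -mulmxA (mulmxA V^T).
  by rewrite tr_cols_of_mul // mul1mx -dot_prodE ogs.
- move=> _ v /mapP[g _ ->] vr.
  rewrite dot_prodE trmx_mul -mulmxA.
  suff -> : V^T *m v = 0 by rewrite mulmx0 mxE.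
  apply/colP => l; rewrite !mxE -[RHS](ovr vs`_l v (mem_nth 0 (ltn_ord l)) vr).
  by apply: eq_bigr => k _; rewrite !mxE.
Qed.

End Orthonormal.

(** * Frontiers of the tree of cubes *)

(** Sorting the indices by their image under [f]; it serves to group children by
    parent and nodes by cube. *)
Lemma big_fiber (I J : eqType) (f : I -> J) (r : seq I) (s : seq J)
    (P : pred I) (F : I -> nat) :
  uniq s -> {in r, forall i, P i -> f i \in s} ->
  (\sum_(k <- s) \sum_(i <- r | P i && (f i == k)) F i =
   \sum_(i <- r | P i) F i)%N.
Proof.
move=> us fs; rewrite (exchange_big_dep P) //=; last by move=> ? ? _ /andP[].
rewrite big_seq_cond [RHS]big_seq_cond; apply: eq_bigr => i /andP[ir Pi].
rewrite Pi /= -(big_filter s) (_ : filter _ _ = [:: f i]) ?big_seq1 //.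
apply: perm_small_eq => //; apply: uniq_perm; rewrite ?filter_uniq // => k.
by rewrite mem_filter inE eq_sym andb_idr // => /eqP ->; apply: fs.
Qed.

Section Frontier.
Variables (N p : nat) (cell : nat -> 'I_N -> cube_index).
Hypothesis cell0 : forall i, cell 0%N i = root_cube.
Hypothesis cellS : forall j i, parent (cell j.+1 i) = cell j i.

Lemma mem_cubes j k :
  (k \in cubes p cell j) = [exists i, cell j i == k] && in_tree p cell j k.
Proof.
rewrite mem_filter mem_undup andbC; congr (_ && _).
by apply/codomP/existsP => [[i ->]|[i /eqP <-]]; exists i.
Qed.

Lemma cell_in_cubes j i :
  (cell j i \in cubes p cell j) = in_tree p cell j (cell j i).
Proof. by rewrite mem_cubes; case: existsP => // -[]; exists i. Qed.

Lemma cubes_uniq j : uniq (cubes p cell j).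
Proof. by rewrite filter_uniq ?undup_uniq. Qed.

Lemma parent_in_cubes j l :
  l \in cubes p cell j.+1 -> parent l \in cubes p cell j.
Proof.
rewrite mem_cubes => /andP[/existsP[i /eqP <-] /=].
by rewrite cellS cell_in_cubes => /and3P[].
Qed.

Lemma in_tree_cellS j i :
  in_tree p cell j.+1 (cell j.+1 i) =
  in_tree p cell j (cell j i) && (max_nodes p < #|nodes cell j (cell j i)|)%N.
Proof.
rewrite /= cellS; congr (_ && _); rewrite andb_idr // => _.
by apply/set0Pn; exists i; rewrite inE.
Qed.

(** The next cell of any node of a subdivided cube is nonempty, hence a child of
    that cube; so a cube without children is one that is not subdivided. *)
Lemma children_cell_nil j i :
  in_tree p cell j (cell j i) ->
  (children p cell j (cell j i) == [::]) = ~~ in_tree p cell j.+1 (cell j.+1 i).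
Proof.
move=> tji; apply/eqP/idP => [nil | ].
  apply/negP => tSji; suff : cell j.+1 i \in [::] by [].
  by rewrite -nil mem_filter cellS eqxx cell_in_cubes.
rewrite in_tree_cellS tji /= => small.
apply/eqP; rewrite -size_eq0 -leqn0 leqNgt -has_predT.
apply/hasP => -[l]; rewrite mem_filter => /andP[/eqP pl].
by rewrite mem_cubes /= pl (negPf small) /= !andbF.
Qed.

Lemma cubes0 (i : 'I_N) : cubes p cell 0 = [:: root_cube].
Proof.
apply: perm_small_eq => //; apply: uniq_perm => // [|k].
  exact: cubes_uniq.
rewrite mem_cubes inE /= andb_idl // => /eqP ->.
by apply/existsP; exists i; rewrite cell0.
Qed.

Variable R : realType.
Variables (C D : nat -> cube_index -> seq 'cV[R]_N).

Definition averages j : seq 'cV[R]_N :=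
  flatten [seq C j k | k <- cubes p cell j].

Definition details j : seq 'cV[R]_N :=
  flatten [seq D j k | k <- cubes p cell j].

Lemma flatten_details (js : seq nat) :
  flatten [seq details j | j <- js] =
  flatten [seq D j k | j <- js, k <- cubes p cell j].
Proof. by elim: js => //= j js ->; rewrite flatten_cat. Qed.

Definition inputs j : seq 'cV[R]_N :=
  flatten [seq cube_vectors p cell C j k | k <- cubes p cell j].

(** The unit vectors of the nodes whose leaf has level less than [j]; they are
    still untouched once the levels [j] and finer have been treated. *)
Definition waiting j : seq 'cV[R]_N :=
  [seq unit_vec R i | i <- enum 'I_N & ~~ in_tree p cell j (cell j i)].

Lemma waiting0 : waiting 0 = [::].
Proof.
rewrite /waiting (eq_filter (a2 := pred0)) ?filter_pred0 // => i.
by rewrite /= cell0 eqxx.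
Qed.

(** The averages of level [j.+1] are the same on both sides, grouped by parent
    in [inputs j].  Among the unit vectors of [waiting j.+1], those of the leaves
    of level exactly [j] have become inputs and the others go on waiting. *)
Lemma perm_frontier_inputs j :
  perm_eq (averages j.+1 ++ waiting j.+1) (inputs j ++ waiting j).
Proof.
apply/permP => P.
have flattenE (I : Type) (s : seq I) (F : I -> seq 'cV[R]_N) :
    count P (flatten [seq F k | k <- s]) = (\sum_(k <- s) count P (F k))%N.
  by rewrite count_flatten sumnE !big_map.
have unitsE (s : seq 'I_N) :
    count P [seq unit_vec R i | i <- s] = (\sum_(i <- s) P (unit_vec R i))%N.
  by rewrite -sumn_count -map_comp sumnE big_map.
have waitingE l : count P (waiting l) =
    (\sum_(i <- enum 'I_N | ~~ in_tree p cell l (cell l i)) P (unit_vec R i))%N.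
  by rewrite unitsE big_filter.
pose leaf i := in_tree p cell j (cell j i) &&
  ~~ in_tree p cell j.+1 (cell j.+1 i).
(* The averages of the children and the nodes of a leaf can be added up for
   every cube, since one of the two sums is empty. *)
have inputE k : k \in cubes p cell j ->
    count P (cube_vectors p cell C j k) =
    (\sum_(l <- cubes p cell j.+1 | parent l == k) count P (C j.+1 l) +
     \sum_(i <- enum 'I_N | leaf i && (cell j i == k)) P (unit_vec R i))%N.
  move=> kj; rewrite /cube_vectors -big_filter -/(children p cell j k).
  have leafE i : leaf i && (cell j i == k) =
      (cell j i == k) && (children p cell j k == [::]).
    rewrite andbC; case: eqP => //= eik.
    have tji : in_tree p cell j (cell j i) by rewrite -cell_in_cubes eik.
    by rewrite -eik children_cell_nil // /leaf tji.
  rewrite (eq_bigl _ _ leafE) big_enum_cond /=.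
  case: (children p cell j k) => [|l ls].
    rewrite big_nil add0n unitsE big_enum /=.
    by apply: eq_bigl => i; rewrite inE andbT.
  by rewrite flattenE [X in (_ + X)%N]big_pred0 ?addn0 // => i; rewrite andbF.
rewrite !count_cat /averages /inputs !flattenE !waitingE.
rewrite [X in (_ = X + _)%N]big_seq (eq_bigr _ inputE) -big_seq big_split /=.
rewrite (big_fiber (P := predT)) ?cubes_uniq //; last first.
  by move=> l lj _; apply: parent_in_cubes.
rewrite big_fiber ?cubes_uniq //; last first.
  by move=> i _ /andP[tji _]; rewrite cell_in_cubes.
rewrite -addnA; congr addn.
rewrite (bigID (fun i => in_tree p cell j (cell j i))) /=; congr addn.
  by apply: eq_bigl => i; rewrite andbC.
apply: eq_bigl => i; have /= -> := in_tree_cellS j i.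
by case: (in_tree p cell j (cell j i)); rewrite ?andbF.
Qed.

End Frontier.

Theorem lemma3 (R : realType) (N m p : nat) (x : 'I_N -> 'rV[R]_3)
    (x_inj : injective x)
    (x_cube : forall i c, 0 <= x i 0 c <= 1)
    (le_mp : (m <= p)%N)
    (x_unisolvent : unisolvent x m)
    (r : nat -> nat) (Q : forall d, 'M[R]_(N, r d))
    (Q_basis : forall d, poly_basis_mx x d (Q d))
    (cell : nat -> 'I_N -> {ffun 'I_3 -> nat})
    (cell_assign : assignment x cell)
    (n : nat) (n_max : largest_level p cell n)
    (C D : nat -> {ffun 'I_3 -> nat} -> seq 'cV[R]_N) (C' D' : seq 'cV[R]_N)
    (hier : hierarchical_basis p m cell Q C D n C' D') :
  basis_of fullv (all_vectors p cell D n C' D') /\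
  orthonormal_seq (all_vectors p cell D n C' D').
Proof.
case: cell_assign => cell0 cellS _; case: hier => decs dec_root.
case: n_max => -[k0 k0n] le_n.
(* The root is a cube of the tree only because there is a node. *)
have [i0 _] : exists i, cell n i = k0.
  by move: k0n; rewrite (mem_cubes p) => /andP[/existsP[i /eqP]]; exists i.
(* Upward induction on the levels: [t] counts the levels treated so far. *)
have frontier t j : (j + t = n.+1)%N ->
    replaces [seq unit_vec R i | i <- enum 'I_N]
      ((averages p cell C j ++ waiting p cell R j) ++
       flatten [seq details p cell D l | l <- iota j t]).
  elim: t j => [|t IH] j.
    (* No cube has level [n.+1], so every unit vector is still waiting. *)
    rewrite addn0 => ->; rewrite cats0.
    have empty : cubes p cell n.+1 = [::].
      case E: (cubes p cell n.+1) => [//|k s].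
      by have := le_n n.+1 k; rewrite E mem_head ltnn => /(_ isT).
    rewrite /averages /waiting empty (eq_filter (a2 := predT)).
      by rewrite filter_predT; apply: replaces_perm.
    by move=> i; rewrite -cell_in_cubes empty.
  rewrite addnS -addSn => jt; apply: replaces_trans (IH _ jt) _.
  rewrite /= [X in replaces _ X]catA.
  apply: replaces_cat; last exact: replaces_perm.
  apply: replaces_trans.
    exact/replaces_perm/(perm_frontier_inputs p cellS).
  have dec : replaces (inputs p cell C j)
      (averages p cell C j ++ details p cell D j).
    apply: replaces_flatten => k kj.
    apply: decomposition_replaces (decs _ _ _ kj).
    by rewrite -ltnS -jt addSn ltnS leq_addr.
  apply: replaces_trans (replaces_cat dec (replaces_perm (perm_refl _))) _.
  by apply: replaces_perm; rewrite -!catA perm_cat2l perm_catC.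
have all_repl : replaces [seq unit_vec R i | i <- enum 'I_N]
    (all_vectors p cell D n C' D').
  apply: replaces_trans (frontier n.+1 0%N (add0n _)) _.
  rewrite waiting0 // cats0 /averages (cubes0 p cell0 i0).
  rewrite [flatten (map _ _)]cats0 flatten_details /all_vectors [C' ++ _]catA.
  apply: replaces_cat; last exact: replaces_perm.
  exact: decomposition_replaces dec_root.
have := all_repl [::]; rewrite !cats0.
move=> /(_ (@orthonormal_unit_vec R N))[sz os].
by split=> //; apply: orthonormal_basis; rewrite // sz size_map size_enum_ord.
Qed.
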